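(* Let $(X,\mathcal B,\mu)$ and $(Y,\mathcal C,\nu)$ be two probability spaces and let $f:X\to X$ and $g:Y\to Y$ be two measurable endomorphisms such that $\mu$ is $f$-invariant and $\nu$ is $g$-invariant. (i) If $\phi:X\to Y$ is measurable such that $\phi\circ f=g\circ\phi$ $\mu$-a.e. and $\phi_*\mu=\nu$, then $h^-_{f,inf}(\mu)\ge h^-_{g,inf}(\nu)$ and $h^-_{f,sup}(\mu)\ge h^-_{g,sup}(\nu)$. (ii) If $\phi:X\to Y$ is an isomorphism of probability spaces such that $\phi\circ f=g\circ\phi$ $\mu$-a.e. and $\phi_*\mu=\nu$, then $h^-_{f,inf}(\mu)=h^-_{g,inf}(\nu)$ and $h^-_{f,sup}(\mu)=h^-_{g,sup}(\nu)$. (iii) If $\phi:X\to Y$ is an isomorphism of probability spaces such that $\phi\circ f=g\circ\phi$ $\mu$-a.e., $\phi_*\mu=\nu$, and $\mu$ has inverse partition entropy with respect to $f$, then $\nu$ has inverse partition entropy with respect to $g$ and $h^-_f(\mu)=h^-_g(\nu)$.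
   Context: Probability spaces are standard Borel, with measures extended to their completions. For $f:X\to X$, the inverse limit is $\widehat X=\{\hat x=(x_0,x_{-1},x_{-2},\ldots): x_{-i}\in X,\ f(x_{-i})=x_{-i+1},\ i\ge1\}$, $\pi(\hat x)=x_0$, $\hat f(x_0,x_{-1},\ldots)=(f(x_0),x_0,x_{-1},\ldots)$; $\hat\mu$ is the unique $\hat f$-invariant probability measure on $\widehat X$ with $\pi_*\hat\mu=\mu$. Inverse partition entropy: for a measurable partition $\mathcal P$ with atoms $\mathcal P(x)\ni x$, put $\mathcal P_n^-(\hat x)=\{y\in X:\exists\,\hat y\in\widehat X,\ y_0=y,\ y_{-i}\in\mathcal P(x_{-i}),\ 0\le i\le n\}$. Let $h^-_{f,inf}(\mu,\mathcal P)$, $h^-_{f,sup}(\mu,\mathcal P)$ be the $\hat\mu$-integrals of $\liminf_n\frac{-\log\mu(\mathcal P_n^-(\hat x))}{n}$, resp. $\limsup_n\frac{-\log\mu(\mathcal P_n^-(\hat x))}{n}$, and let $h^-_{f,inf}(\mu)$, $h^-_{f,sup}(\mu)$ be their suprema over measurable partitions with $H_\mu(\mathcal P)<\infty$. If these are equal, $\mu$ has inverse partition entropy with respect to $f$ and $h^-_f(\mu)$ is the common value. The same definitions apply to $(Y,g,\nu)$. *)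

(* Defs.v *)
From HB Require Import structures.
From mathcomp Require Import all_boot all_order all_algebra.
From mathcomp Require Import all_classical all_reals all_analysis.

Set Implicit Arguments.
Unset Strict Implicit.
Unset Printing Implicit Defensive.

Import Order.TTheory GRing.Theory Num.Theory.

Local Open Scope classical_set_scope.
Local Open Scope ring_scope.
Local Open Scope ereal_scope.

(* The sigma-algebra of X is the Borel sigma-algebra of a Polish space, up to
   the relabelling h. *)
Definition standard_borel (R : realType) (d : measure_display)
    (X : measurableType d) : Prop :=
  exists (T : completePseudoMetricType R) (h : X -> T),
    [/\ hausdorff_space T, @second_countable T, bijective h &
        forall A : set X, measurable A <-> <<s [set U : set T | open U] >> (h @` A)].

Definition preserves_measure (R : realType) (d d' : measure_display)
    (X : measurableType d) (Y : measurableType d')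
    (mu : set X -> \bar R) (nu : set Y -> \bar R) (phi : X -> Y) : Prop :=
  forall A : set Y, measurable A -> mu (phi @^-1` A) = nu A.

(* Isomorphism modulo null sets. *)
Definition probability_isomorphism (R : realType) (d d' : measure_display)
    (X : measurableType d) (Y : measurableType d')
    (mu : probability X R) (nu : probability Y R) (phi : X -> Y) : Prop :=
  [/\ measurable_fun setT phi, preserves_measure mu nu phi &
      exists (X0 : set X) (Y0 : set Y),
        [/\ measurable X0 /\ mu X0 = 1, measurable Y0 /\ nu Y0 = 1,
            set_bij X0 Y0 phi &
            forall A : set X, measurable A -> A `<=` X0 ->
              measurable (phi @` A)]].

Section inverse_limit.
Variables (d : measure_display) (X : measurableType d).

Definition coordinate_events : set (set (nat -> X)) :=
  \bigcup_(i in [set: nat])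
    preimage_set_system setT (fun x : nat -> X => x i) measurable.

(* X^nat with the product sigma-algebra; the i-th coordinate of x is x_{-i}. *)
Definition past_space := g_sigma_algebraType coordinate_events.

Definition invlim (f : X -> X) : set past_space :=
  [set x : nat -> X | forall i, f (x i.+1) = x i].

Definition invlim_proj (x : past_space) : X := (x : nat -> X) 0%N.

Definition invlim_map (f : X -> X) (x : past_space) : past_space :=
  fun i => if i is j.+1 then (x : nat -> X) j else f (invlim_proj x).

(* Measures on the inverse limit are represented by measures on X^nat carried by
   it (it is measurable in X^nat when X is standard Borel), so that no point of
   the inverse limit is needed to build a measurableType. *)
Definition invlim_measure (R : realType) (f : X -> X) (mu : probability X R)
    (muhat : probability past_space R) : Prop :=
  [/\ muhat (invlim f) = 1,
      preserves_measure muhat muhat (invlim_map f) &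
      preserves_measure muhat mu invlim_proj].

End inverse_limit.

Arguments invlim {d X} f.
Arguments invlim_proj {d X} x.
Arguments invlim_map {d X} f x.

Section partitions.
Variables (R : realType) (d : measure_display) (X : measurableType d).

(* Measurable partition in the sense of Rokhlin: countably many measurable
   unions of atoms separate the atoms. *)
Definition measurable_partition (P : set (set X)) : Prop :=
  partition P id setT /\
  exists B : nat -> set X,
    [/\ forall n, measurable (B n),
        forall n C, P C -> C `<=` B n \/ C `<=` ~` B n &
        forall C C', P C -> P C' -> C <> C' -> exists n,
          (C `<=` B n /\ C' `<=` ~` B n) \/ (C `<=` ~` B n /\ C' `<=` B n)].

Definition atom (P : set (set X)) (x : X) : set X := pblock P id x.

(* +oo when the atoms of positive measure do not exhaust X modulo mu; this does
   not occur for countable partitions. *)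
Definition partition_entropy (mu : probability X R) (P : set (set X)) : \bar R :=
  if mu (\bigcup_(C in [set C | P C /\ 0 < mu C]) C) == 1
  then \esum_(C in P) - (mu C * lne (mu C))
  else +oo.

End partitions.

Section inverse_partition_entropy.
Variables (R : realType) (d : measure_display) (X : measurableType d).
Variables (f : X -> X) (mu : probability X R).
Variable muhat : probability (past_space X) R.

Definition inverse_cell (P : set (set X)) (n : nat) (x : past_space X) : set X :=
  [set y | exists yhat : past_space X,
    [/\ invlim f yhat, invlim_proj yhat = y &
        forall i, (i <= n)%N ->
          atom P ((x : nat -> X) i) ((yhat : nat -> X) i)]].

(* inverse_cell is in general only an analytic set. It is measured by the outer
   measure of mu, which coincides with the completion of mu on its domain. The
   term n = 0 has a junk value, irrelevant for the limits. *)
Definition inverse_rate (P : set (set X)) (x : past_space X) (n : nat) : \bar R :=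
  - lne ((mu^*)%mu (inverse_cell P n x)) * (n%:R^-1)%:E.

Definition h_inf_partition (P : set (set X)) : \bar R :=
  \int[muhat]_(x in invlim f) limn_einf (inverse_rate P x).

Definition h_sup_partition (P : set (set X)) : \bar R :=
  \int[muhat]_(x in invlim f) limn_esup (inverse_rate P x).

Definition finite_entropy_partitions : set (set (set X)) :=
  [set P | measurable_partition P /\ partition_entropy mu P < +oo].

Definition h_inf : \bar R :=
  ereal_sup [set h_inf_partition P | P in finite_entropy_partitions].

Definition h_sup : \bar R :=
  ereal_sup [set h_sup_partition P | P in finite_entropy_partitions].

Definition has_inverse_partition_entropy : Prop := h_inf = h_sup.

(* Meaningful only under has_inverse_partition_entropy. *)
Definition inverse_partition_entropy : \bar R := h_inf.

End inverse_partition_entropy.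

(* Main.v *)
(* A factor map [phi] acts on pasts coordinatewise and sends the natural extension
   of [mu] to that of [nu], by uniqueness of the latter. Given a partition [P] of
   [Y] with finite entropy, we pull it back to [X], but put into one extra atom
   the null set of points [x] where [phi \o f] and [g \o phi] differ, or where
   [phi x] follows a word of atoms of [P] while escaping from a measurable
   envelope of the corresponding inverse cell. For almost every past the inverse
   cell of this pulled back partition then lies in the preimage of an envelope of
   the inverse cell of [P], so its outer measure is not larger. This compares the
   rates, hence the entropies. An isomorphism is a factor map in both
   directions. *)
Require Import Defs.
From HB Require Import structures.
From mathcomp Require Import all_boot all_order all_algebra.
From mathcomp Require Import finmap.
From mathcomp Require Import all_classical all_reals all_analysis.
From mathcomp Require Import measurable_realfun.
Import Order.TTheory GRing.Theory Num.Theory.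
Import HBNNSimple.
Local Open Scope classical_set_scope.
Local Open Scope ring_scope.
Local Open Scope ereal_scope.

Set Implicit Arguments.
Unset Strict Implicit.
Unset Printing Implicit Defensive.

(** * Sets of full measure, integrals and limits *)

Lemma measurable_preim d d' (T : measurableType d) (T' : measurableType d')
    (h : T -> T') (A : set T') :
  measurable_fun setT h -> measurable A -> measurable (h @^-1` A).
Proof. by move=> mh mA; rewrite -[X in measurable X]setTI; exact: mh. Qed.

Lemma measurable_iff d (T : measurableType d) (A B : set T) :
  measurable A -> measurable B -> measurable [set x | A x <-> B x].
Proof.
move=> mA mB; rewrite (_ : mkset _ = (A `&` B) `|` (~` A `&` ~` B)).
  by apply: measurableU; apply: measurableI => //; exact: measurableC.
apply/seteqP; split => x /=; last by tauto.
by move=> AB; have [Ax|nAx] := pselect (A x); [left|right]; split => //; tauto.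
Qed.

Lemma measurable_forall_nat d (T : measurableType d) (A : nat -> set T) :
  (forall i, measurable (A i)) -> measurable [set x | forall i, A i x].
Proof.
move=> mA; rewrite (_ : mkset _ = \bigcap_i A i); first exact: bigcapT_measurable.
by apply/seteqP; split=> x /= Ax i //; exact: Ax.
Qed.

Lemma measurable_implb d (T : measurableType d) (b : bool) (A : set T) :
  measurable A -> measurable [set x | b -> A x].
Proof.
case: b => mA; last by rewrite (_ : mkset _ = setT) //; apply/seteqP.
by rewrite (_ : mkset _ = A) //; apply/seteqP; split=> x /=; [exact|].
Qed.

Section full_measure.
Variables (R : realType) (d : measure_display) (T : measurableType d).
Variable m : probability T R.

Lemma full_setC (E : set T) : measurable E -> (m E = 1) <-> (m (~` E) = 0).
Proof.
move=> mE; rewrite probability_setC // -(fineK (fin_num_measure m _ mE)) -EFinB.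
by split=> [[->]|[/eqP]]; rewrite ?subrr // subr_eq0 => /eqP <-.
Qed.

(** Cutting a set down to [E] removes only part of a null set, so both measures are those of the
    common trace on [E]. *)
Lemma full_measure_eq (E A B : set T) : measurable E -> measurable A ->
  measurable B -> m E = 1 -> A `&` E = B `&` E -> m A = m B.
Proof.
move=> mE mA mB /(full_setC mE) E0.
suff H C : measurable C -> m C = m (C `&` E) by move=> AB; rewrite H // AB -H.
move=> mC; rewrite [LHS](measureDI m mC mE) [X in X + _](_ : _ = 0) ?add0e //.
apply: (@subset_measure0 _ _ _ m _ (~` E)) => //.
- exact: measurableD.
- exact: measurableC.
Qed.

Lemma full_measure_ge (E A : set T) : measurable E -> measurable A ->
  m E = 1 -> E `<=` A -> m A = 1.
Proof.
move=> mE mA E1 EA; apply/eqP; rewrite eq_le probability_le1 //= -E1.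
by rewrite le_measure ?inE.
Qed.

Lemma full_measureI (E F : set T) : measurable E -> measurable F ->
  m E = 1 -> m F = 1 -> m (E `&` F) = 1.
Proof.
move=> mE mF E1 F1; rewrite -F1; apply: (full_measure_eq mE) => //.
  exact: measurableI.
by rewrite -setIA (setIC F) setIA setIid.
Qed.

Lemma full_measure_bigcap (E : nat -> set T) : (forall i, measurable (E i)) ->
  (forall i, m (E i) = 1) -> m [set x | forall i, E i x] = 1.
Proof.
move=> mE E1; apply/full_setC; first exact: measurable_forall_nat.
have mC : measurable (~` [set x | forall i, E i x]).
  by apply: measurableC; exact: measurable_forall_nat.
apply/(negligibleP m mC); apply: (@negligibleS _ _ _ m (\bigcup_i ~` E i)).
  by move=> x /existsNP[i Ei]; exists i.
apply: negligible_bigcup => i; apply/negligibleP; first exact: measurableC.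
exact/(full_setC (mE i)).
Qed.

Lemma ae_full_measure (P : set T) : {ae m, forall x, P x} ->
  exists E, [/\ measurable E, m E = 1 & E `<=` P].
Proof.
move=> [N [mN N0 PN]]; exists (~` N); split; first exact: measurableC.
  by apply/full_setC; [exact: measurableC|rewrite setCK].
by move=> x Nx; apply: contrapT => Px; exact/Nx/PN.
Qed.

End full_measure.

Section integral_transfer.
Variables (R : realType) (d d' : measure_display).
Variables (T : measurableType d) (T' : measurableType d').

Lemma preserves_measure_integral (m : probability T R) (m' : probability T' R)
    (h : T -> T') (F : T' -> \bar R) :
  measurable_fun setT h -> preserves_measure m m' h ->
  measurable_fun setT F -> (forall y, 0 <= F y) ->
  \int[m']_y F y = \int[m]_x F (h x).
Proof.
move=> mh hmm' mF F0.
have <- : \int[pushforward m h]_y F y = \int[m']_y F y.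
  by apply: eq_measure_integral => //= A mA _; exact: hmm'.
by rewrite (ge0_integral_pushforward mh).
Qed.

(* The integral of a nonnegative function is defined as a lower integral, so
   that no measurability is needed here. *)
Lemma ge0_le_integral_transfer (m : probability T R) (m' : probability T' R)
    (h : T -> T') (E : set T) (D : set T) (D' : set T')
    (F : T -> \bar R) (F' : T' -> \bar R) :
  measurable_fun setT h -> preserves_measure m m' h ->
  measurable E -> m E = 1 ->
  (forall x, 0 <= F x) -> (forall y, 0 <= F' y) ->
  E `<=` D -> (forall x, E x -> F' (h x) <= F x) ->
  \int[m']_(y in D') F' y <= \int[m]_(x in D) F x.
Proof.
move=> mh hmm' mE E1 F0 F'0 ED FF'.
rewrite ge0_integralE // ge0_integralE //.
(* It suffices to bound the integral of each simple [k] below [F']. It equals that of [k \o h],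
   which is cut down to [E], where [k \o h] lies below [F]. *)
apply: ge_ereal_sup => _ [k kF' <-].
rewrite -integralT_nnsfun (preserves_measure_integral mh hmm').
- rewrite (@ge0_negligible_integral _ _ _ m setT (~` E)) //.
  + rewrite setTD setCK ge0_integralE; last by move=> x _; rewrite lee_fin.
    apply: le_ereal_sup => _ [k' k'F <-]; exists k' => // x.
    apply: (le_trans (k'F x)); rewrite /patch; case: ifPn => xE.
      rewrite mem_set; last exact/ED/set_mem.
      apply: le_trans (FF' x (set_mem xE)); apply: le_trans (kF' (h x)) _.
      by rewrite /patch; case: ifPn.
    by case: ifPn.
  + exact: measurableC.
  + apply/measurable_EFinP; apply: (measurableT_comp _ mh) => //.
  + by move=> x _; rewrite lee_fin.
  + exact/full_setC.
- exact/measurable_EFinP.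
- by move=> y; rewrite lee_fin.
Qed.

End integral_transfer.

Section limits.
Variable R : realType.
Implicit Types u v : nat -> \bar R.

Lemma le_limn_esup u v : (forall n, u n <= v n) -> limn_esup u <= limn_esup v.
Proof.
move=> uv; rewrite /limn_esup /limf_esup; apply: le_ereal_inf_tmp => _ [A FA <-].
apply: (@le_trans _ _ (ereal_sup (u @` A))).
  by apply: ereal_inf_lbound; exists A.
by apply: ge_ereal_sup => _ [n An <-]; apply: le_trans (uv n) _;
  apply: ereal_sup_ubound; exists n.
Qed.

Lemma le_limn_einf u v : (forall n, u n <= v n) -> limn_einf u <= limn_einf v.
Proof.
by move=> uv; rewrite /limn_einf leeN2; apply: le_limn_esup => n; rewrite leeN2.
Qed.

Lemma limn_einf_ge0 u : (forall n, 0 <= u n) -> 0 <= limn_einf u.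
Proof.
move=> u0; rewrite /limn_einf -[leLHS]oppe0 leeN2 /limn_esup /limf_esup.
apply: (@le_trans _ _ (ereal_sup (range (\- u)))).
  by apply: ereal_inf_lbound; exists setT => //; exact: filterT.
by apply: ge_ereal_sup => _ [n _ <-]; rewrite oppe_le0.
Qed.

Lemma limn_esup_ge0 u : (forall n, 0 <= u n) -> 0 <= limn_esup u.
Proof. by move=> u0; exact: le_trans (limn_einf_ge0 u0) (limn_einf_sup _). Qed.

End limits.

(** * The space of pasts *)

(** The [U n] are pulled back from a countable base, which tells points apart in a Hausdorff space.
    They turn an equality of points into countably many measurable conditions. *)
Lemma standard_borel_separating (R : realType) (d : measure_display)
    (X : measurableType d) : standard_borel R X ->
  exists U : nat -> set X, (forall n, measurable (U n)) /\
    forall x y, (forall n, U n x <-> U n y) -> x = y.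
Proof.
move=> [T [h [hT [B cB [Bo Bnbhs]] [k hk kh] mX]]].
have inj x y : h x = h y -> x = y by move=> /(congr1 k); rewrite !hk.
have sep x y : (forall V, B V -> V (h x) <-> V (h y)) -> x = y.
  move=> Vxy; apply/inj/eqP; apply: contrapT => /negP xy.
  have [A [oA]] := hausdorff_accessible hT xy; rewrite !inE => Ax Ay.
  have [V [BV Vx] VA] := Bnbhs (h x) A (open_nbhs_nbhs (conj oA Ax)).
  by apply/Ay/VA; apply/(Vxy V BV).
have mB V : B V -> measurable (h @^-1` V).
  move=> /Bo oV; apply/mX; rewrite image_preimage.
    exact: sub_sigma_algebra.
  by apply/seteqP; split=> // t _; exists (k t).
have [B0|/unsquash e] := pfcard_geP cB.
  exists (fun _ => set0); split => // x y _; apply: sep => V.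
  by rewrite B0.
exists (fun n => h @^-1` e n); split => [n|x y xy].
  by apply: mB; exact: funS.
apply: sep => V BV; have [n _ <-] := surj (f := e) BV; exact: xy.
Qed.

Section past_space.
Variables (d : measure_display) (X : measurableType d).

Definition past_coord (i : nat) (x : past_space X) : X := (x : nat -> X) i.

Lemma measurable_past_coord i : measurable_fun setT (past_coord i).
Proof.
move=> _ A mA; rewrite setTI; apply: sub_sigma_algebra.
by exists i => //; exists A => //; rewrite setTI.
Qed.

Lemma measurable_past_preim i (A : set X) :
  measurable A -> measurable (past_coord i @^-1` A).
Proof. by move=> mA; apply: measurable_preim => //; exact: measurable_past_coord. Qed.

Lemma measurable_into_past d' (T : measurableType d') (h : T -> past_space X) :
  (forall i, measurable_fun setT (past_coord i \o h)) -> measurable_fun setT h.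
Proof.
move=> mh; apply: (@measurability _ _ T (past_space X) setT h (@coordinate_events _ X)) => //.
move=> _ [_ [i _ [A mA <-]] <-]; rewrite setTI; exact: mh.
Qed.

Definition cylinder (A : nat -> set X) (n : nat) : set (past_space X) :=
  [set x | forall i, (i <= n)%N -> A i (past_coord i x)].

Lemma measurable_cylinder A n :
  (forall i, measurable (A i)) -> measurable (cylinder A n).
Proof.
move=> mA; apply: (@measurable_forall_nat _ _
  (fun i => [set x | (i <= n)%N -> A i (past_coord i x)])) => i.
apply: (@measurable_implb _ _ _ (past_coord i @^-1` A i)).
exact: measurable_past_preim.
Qed.

Lemma past_measure_unique (R : realType) (m1 m2 : {measure set (past_space X) -> \bar R}) :
  m1 setT < +oo ->
  (forall A n, (forall i, measurable (A i)) -> m1 (cylinder A n) = m2 (cylinder A n)) ->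
  forall C, measurable C -> m1 C = m2 C.
Proof.
move=> m1oo m12 C mC.
pose G := [set D | exists A n, (forall i, measurable (A i)) /\ D = cylinder A n].
have GT : G setT.
  by exists (fun _ => setT), 0%N; split => //; apply/seteqP; split.
have sG : measurable = <<s G >>.
  apply/seteqP; split.
    apply: smallest_sub; first exact: smallest_sigma_algebra.
    move=> _ [i _ [A mA <-]]; apply: sub_sigma_algebra.
    exists (fun j => if j == i then A else setT), i; split.
      by move=> j; case: ifP.
    apply/seteqP; split=> x /=.
      by move=> [_ Ax] j _; case: eqP => // ->.
    by move=> /(_ i (leqnn i)); rewrite eqxx.
  apply: smallest_sub; first exact: sigma_algebra_measurable.
  by move=> _ [A [n [mA ->]]]; exact: measurable_cylinder.
have GI : setI_closed G.
  move=> _ _ [A [n [mA ->]]] [B [p [mB ->]]].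
  (* Each constraint is guarded by its own depth, so that the shallower cylinder stays free between
     the two depths. *)
  exists (fun i => [set x | (i <= n)%N -> A i x] `&` [set x | (i <= p)%N -> B i x]).
  exists (maxn n p); split.
    by move=> i; apply: measurableI; exact: measurable_implb.
  apply/seteqP; split=> x /=.
    by move=> [Ax Bx] i _; split => [/Ax|/Bx].
  by move=> ABx; split=> i le_i; have [] := ABx i; rewrite ?leq_max ?le_i ?orbT //;
    auto.
apply: (measure_unique G (fun _ => setT) sG GI) => //.
- by apply/seteqP; split=> // x _; exists 0%N.
- by move=> D [A [n [mA ->]]]; exact: m12.
Qed.

Lemma measurable_iter (f : X -> X) k :
  measurable_fun setT f -> measurable_fun setT (iter k f).
Proof.
move=> mf; elim: k => [|k IH]; first exact: measurable_id.
by apply: (measurableT_comp mf IH).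
Qed.

(** Each equation between consecutive coordinates is tested on the countable separating family,
    which leaves a countable intersection of measurable events. *)
Lemma measurable_invlim (R : realType) (f : X -> X) :
  standard_borel R X -> measurable_fun setT f -> measurable (invlim f).
Proof.
move=> /standard_borel_separating[U [mU sepU]] mf.
rewrite (_ : invlim f = [set x | forall i n,
   (past_coord i.+1 @^-1` (f @^-1` U n)) x <-> (past_coord i @^-1` U n) x]).
  apply: (@measurable_forall_nat _ _ (fun i => [set x | forall n,
   (past_coord i.+1 @^-1` (f @^-1` U n)) x <-> (past_coord i @^-1` U n) x])) => i.
  apply: (@measurable_forall_nat _ _ (fun n => [set x |
   (past_coord i.+1 @^-1` (f @^-1` U n)) x <-> (past_coord i @^-1` U n) x])) => n.
  apply: measurable_iff; apply: measurable_past_preim => //.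
  exact: measurable_preim.
apply/seteqP; split=> x /= fx i; last exact/sepU/fx.
by move=> n; rewrite /past_coord fx.
Qed.

Lemma iter_invlim (f : X -> X) x n i : invlim f x -> (i <= n)%N ->
  iter (n - i) f (past_coord n x) = past_coord i x.
Proof.
move=> fx; elim: n => [|n IH] le_in; first by move: le_in; rewrite leqn0 => /eqP->.
move: le_in; rewrite leq_eqVlt => /predU1P[->|]; first by rewrite subnn.
by rewrite ltnS => le_in; rewrite subSn // iterSr {2}/past_coord fx IH.
Qed.

Lemma invlim_cylinder (f : X -> X) (A : nat -> set X) n x : invlim f x ->
  cylinder A n x <-> (forall i, (i <= n)%N -> A i (iter (n - i) f (past_coord n x))).
Proof.
by move=> fx; split=> Ax i le_in; have := Ax i le_in; rewrite (iter_invlim fx).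
Qed.

Lemma measurable_itinerary (f : X -> X) (A : nat -> set X) n :
  measurable_fun setT f -> (forall i, measurable (A i)) ->
  measurable [set z | forall i, (i <= n)%N -> A i (iter (n - i) f z)].
Proof.
move=> mf mA; apply: (@measurable_forall_nat _ _
  (fun i => [set z | (i <= n)%N -> A i (iter (n - i) f z)])) => i.
apply: (@measurable_implb _ _ _ (iter (n - i) f @^-1` A i)).
by apply: measurable_preim => //; exact: measurable_iter.
Qed.

(** [invlim_map f] moves coordinate [i] to position [i.+1], so invariance of [muhat] passes the law
    [mu] on to the next deeper coordinate. *)
Lemma invlim_measure_coord (R : realType) (f : X -> X) (mu : probability X R)
    (muhat : probability (past_space X) R) i :
  measurable_fun setT f ->
  invlim_measure f mu muhat -> preserves_measure muhat mu (past_coord i).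
Proof.
move=> mf [_ inv_muhat muhat_mu]; elim: i => [|i IH] A mA; first exact: muhat_mu.
rewrite -(IH A mA) -(inv_muhat _ (measurable_past_preim i.+1 mA)).
by congr (muhat _); apply/seteqP.
Qed.

(* On the inverse limit a cylinder is determined by its deepest coordinate. *)
Lemma invlim_measure_unique (R : realType) (f : X -> X) (mu : probability X R)
    (m1 m2 : probability (past_space X) R) :
  measurable_fun setT f -> measurable (invlim f) ->
  m1 (invlim f) = 1 -> m2 (invlim f) = 1 ->
  (forall i, preserves_measure m1 mu (past_coord i)) ->
  (forall i, preserves_measure m2 mu (past_coord i)) ->
  forall C, measurable C -> m1 C = m2 C.
Proof.
move=> mf mI m11 m21 m1mu m2mu; apply: past_measure_unique.
  by rewrite /= probability_setT ltry.
(* On the inverse limit the cylinder is the event that coordinate [n] lies in [W]: from there the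
   forward orbit follows [A] up to the present. *)
move=> A n mA; set W := [set z | forall i, (i <= n)%N -> A i (iter (n - i) f z)].
have mW : measurable W by exact: measurable_itinerary.
suff H (m : probability (past_space X) R) : m (invlim f) = 1 ->
    preserves_measure m mu (past_coord n) -> m (cylinder A n) = mu W.
  by transitivity (mu W); [exact: H|exact/esym/H].
move=> mI1 mmu; rewrite -(mmu W mW); apply: (full_measure_eq mI) => //.
- exact: measurable_cylinder.
- exact: measurable_past_preim.
- apply/seteqP; split=> x [Ax fx]; split => //.
    by apply/(invlim_cylinder _ _ fx).
  by apply/(invlim_cylinder _ _ fx).
Qed.

End past_space.

(** * Measurable partitions *)

(** Intersect measurable covers of [A], the [k]-th within [1/(k+1)] of the outer measure. This
    replaces inverse cells by measurable sets. *)
Lemma measurable_envelope (R : realType) (d : measure_display)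
    (X : measurableType d) (mu : probability X R) (A : set X) :
  exists B, [/\ measurable B, A `<=` B & mu B <= (mu^*)%mu A].
Proof.
have muA : (mu^*)%mu A \is a fin_num.
  rewrite ge0_fin_numE ?mu_ext_ge0 //.
  apply: le_lt_trans (le_mu_ext mu (@subsetT _ A)) _.
  by rewrite measurable_mu_extE //= probability_setT ltry.
have H k : exists C, [/\ measurable C, A `<=` C &
    mu C <= (mu^*)%mu A + (k.+1%:R^-1)%:E].
  have k0 : (0 < k.+1%:R^-1 :> R)%R by rewrite invr_gt0.
  have [_ [F [mF AF] <-] /ltW lek] := lb_ereal_inf_adherent k0 muA.
  exists (\bigcup_i F i); split => //; first exact: bigcupT_measurable.
  apply: le_trans lek; apply: generalized_Boole_inequality => //.
  exact: bigcupT_measurable.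
have [C HC] := choice H; exists (\bigcap_k C k); split.
- by apply: bigcapT_measurable => k; have [] := HC k.
- by move=> x Ax k _; have [_ sAC _] := HC k; exact: sAC.
apply/lee_addgt0Pr => e e0.
have [mC _ leC] := HC (Num.truncn e^-1).
apply: (@le_trans _ _ (mu (C (Num.truncn e^-1)))).
  rewrite le_measure ?inE //; last by move=> x; exact.
  by apply: bigcapT_measurable => k; have [] := HC k.
apply: le_trans leC _; rewrite leeD2l // lee_fin.
by rewrite invf_ple ?posrE //; exact/ltW/truncnS_gt.
Qed.

Section measurable_partitions.
Variables (R : realType) (d : measure_display) (X : measurableType d).
Variable P : set (set X).
Hypothesis mP : measurable_partition P.

Lemma atom_mem x : P (atom P x) /\ atom P x x.
Proof.
have [[cP _ _] _] := mP.
have : cover P id x by rewrite cP.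
move=> [C PC Cx].
by apply: (@getPex _ [set D | P D /\ id D x]); exists C.
Qed.

Lemma atom_eq C x : P C -> C x -> atom P x = C.
Proof.
move=> PC Cx; have [[_ tP _] _] := mP; have [Pa ax] := atom_mem x.
by apply: tP => //; exists x.
Qed.

(** An atom is the intersection over [n] of whichever of [B n] and its complement contains it,
    because every other atom is split off by some [n]. *)
Lemma measurable_partition_atom C : P C -> measurable C.
Proof.
move=> PC; have [[cP _ P0] [B [mB PB sepB]]] := mP.
pose B' n := if pselect (C `<=` B n) then B n else ~` B n.
have CB' n : C `<=` B' n.
  by rewrite /B'; case: pselect => // CBn; have [] := PB n C PC.
have mB' n : measurable (B' n).
  by rewrite /B'; case: pselect => ? /=; [exact: mB|exact/measurableC/mB].
rewrite (_ : C = \bigcap_n B' n); first exact: bigcapT_measurable.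
apply/seteqP; split=> [x Cx n _|x B'x]; first exact: CB'.
have [Pa ax] := atom_mem x.
have [aC|aC] := pselect (atom P x = C); first by rewrite -aC.
(* A point of [C] excludes that [C] lies in both [B n] and its complement, which would defeat the
   choice made in [B']. *)
have [c Cc] := P0 C PC.
have [n sep] := sepB _ _ Pa PC aC; move: (B'x n I); rewrite /B'.
case: pselect sep => /= CBn [[aB CB]|[aB CB]] //.
- by move=> _; have := CB c Cc (CBn c Cc).
- by move=> /(aB x ax).
- by move=> /(_ (aB x ax)).
Qed.

Section countable.
Variable mu : probability X R.

Definition positive_atoms : set (set X) := [set C | P C /\ 0 < mu C].

(** At most [k+1] disjoint atoms can have measure at least [1/(k+1)]; the positive atoms are the
    union of these finite families. *)
Lemma countable_positive_atoms : countable positive_atoms.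
Proof.
have -> : positive_atoms =
    \bigcup_k [set C | P C /\ (k.+1%:R^-1)%:E <= mu C].
  apply/seteqP; split=> [C [PC C0]|C [k _ [PC kC]]]; last first.
    by split => //; apply: lt_le_trans kC; rewrite lte_fin invr_gt0.
  have r0 : (0 < fine (mu C))%R.
    by rewrite fine_gt0 // C0 (le_lt_trans (probability_le1 mu _)) ?ltry //;
      exact: measurable_partition_atom.
  exists (Num.truncn (fine (mu C))^-1) => //; split => //.
  rewrite -[leRHS]fineK ?fin_num_measure //; last exact: measurable_partition_atom.
  by rewrite lee_fin invf_ple ?posrE //; exact/ltW/truncnS_gt.
apply: bigcup_countable => // k _; apply: finite_set_countable.
(* Otherwise [k.+2] such atoms would have total measure above 1. *)
apply: contrapT => /(infinite_set_fset k.+2)[F FP sF].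
have [[_ tP _] _] := mP.
have PF C : [set` F] C -> P C by move=> /FP[].
have : mu (\bigcup_(C in [set` F]) C) <= 1.
  apply: probability_le1; apply: fin_bigcup_measurable => // C /PF.
  exact: measurable_partition_atom.
rewrite measure_fin_bigcup //; last 2 first.
- exact: sub_trivIset tP.
- by move=> C /PF; exact: measurable_partition_atom.
rewrite leNgt => /negP; apply.
apply: (@lt_le_trans _ _ (\sum_(C \in [set` F]) (k.+1%:R^-1)%:E)); last first.
  by apply: lee_fsum => // C /FP[].
rewrite fsbig_finite // set_fsetK sumEFin lte_fin big_const_seq iter_addr_0.
rewrite count_predT -[ltRHS]mulr_natr mulrC ltr_pdivlMr ?ltr0n // mul1r ltr_nat.
exact: leq_trans sF.
Qed.

(** The enumeration comes from a surjection of the naturals, so atoms may repeat; when no atom is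
    positive it is constantly [set0]. *)
Lemma enum_positive_atoms : exists e : nat -> set X,
  [/\ forall n, measurable (e n),
      forall C, positive_atoms C -> exists n, e n = C &
      \bigcup_(C in positive_atoms) C = \bigcup_n e n].
Proof.
have meas C : positive_atoms C -> measurable C.
  by move=> [PC _]; exact: measurable_partition_atom.
have [P0|/unsquash e] := pfcard_geP countable_positive_atoms.
  exists (fun _ => set0); rewrite P0; split => //.
  by apply/seteqP; split=> x [].
exists e; split => [n|C PC|].
- by apply: meas; exact: funS.
- by have [n _ <-] := surj (f := e) PC; exists n.
- apply/seteqP; split=> [x [C PC Cx]|x [n _ enx]].
    by have [n _ en] := surj (f := e) PC; exists n => //; rewrite en.
  by exists (e n) => //; exact: funS.
Qed.

End countable.
End measurable_partitions.

Lemma entropy_term_ge0 (R : realType) (p : \bar R) :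
  0 <= p <= 1 -> 0 <= - (p * lne p).
Proof. by move=> /andP[p0 p1]; rewrite oppe_ge0 mule_ge0_le0 // lne_le0. Qed.

Lemma ge0_subset_esum (R : realType) (I : choiceType) (A B : set I)
    (a : I -> \bar R) : A `<=` B -> \esum_(i in A) a i <= \esum_(i in B) a i.
Proof.
move=> AB; apply: le_ereal_sup => _ [F [fF FA] <-]; exists F => //.
by split => //; exact: subset_trans AB.
Qed.

Lemma partition_entropy_fin (R : realType) (d : measure_display)
    (X : measurableType d) (mu : probability X R) (P : set (set X)) :
  partition_entropy mu P < +oo <->
  mu (\bigcup_(C in positive_atoms P mu) C) = 1 /\
  \esum_(C in P) - (mu C * lne (mu C)) < +oo.
Proof.
rewrite /partition_entropy; split; first by case: eqP.
by move=> [/eqP -> ?].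
Qed.

(** * Pulling a partition back along a factor map *)

Section pullback_partition.
Variables (R : realType) (d d' : measure_display).
Variables (X : measurableType d) (Y : measurableType d').
Variables (mu : probability X R) (nu : probability Y R) (phi : X -> Y).
Variables (P : set (set Y)) (G : set X).
Hypotheses (mphi : measurable_fun setT phi) (phi_mu : preserves_measure mu nu phi).
Hypotheses (mP : measurable_partition P) (mG : measurable G) (G1 : mu G = 1).

(* The null set [~` G] gets an atom of its own because its images under the
   dynamics may have positive measure: the cells of almost every past must stay
   away from it. *)
Definition pullback_atom (C : set Y) : set X := phi @^-1` C `&` G.

(** Nonemptiness is imposed because the preimage of a class of [P] may miss [G], and the complement
    of [G] may be empty. *)
Definition pullback_partition : set (set X) :=
  [set D | D !=set0 /\ ((exists2 C, P C & D = pullback_atom C) \/ D = ~` G)].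

Lemma pullback_partition_atom x : G x ->
  pullback_partition (pullback_atom (atom P (phi x))).
Proof.
move=> Gx; have [Pa ax] := atom_mem mP (phi x).
by split; [exists x|left; exists (atom P (phi x))].
Qed.

Lemma measurable_pullback_partition : measurable_partition pullback_partition.
Proof.
have [[cP tP P0] [B [mB PB sepB]]] := mP.
split; first split.
- apply/seteqP; split=> // x _; have [Gx|nGx] := pselect (G x).
    exists (pullback_atom (atom P (phi x))); first exact: pullback_partition_atom.
    by split => //; exact: (atom_mem mP (phi x)).2.
  by exists (~` G) => //; split; [exists x|right].
- move=> D D' [_ [[C PC ->]|->]] [_ [[C' PC' ->]|->]] [x []] //.
  + move=> [Cx _] [C'x _]; congr pullback_atom.
    by rewrite -(atom_eq mP PC Cx) -(atom_eq mP PC' C'x).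
  + by move=> [_ Gx].
  + by move=> nGx [_ /nGx].
- by move=> D [].
(* Index 0 separates the extra atom from the others; index [k.+1] separates pulled back atoms as
   [B k] does the original ones. *)
exists (fun n => if n is k.+1 then pullback_atom (B k) else G); split.
- case=> // k; apply: measurableI => //; exact: measurable_preim.
- move=> [|k] _ [_ [[C PC ->]|->]].
  + by left => x [].
  + by right.
  + have [CB|CB] := PB k C PC; [left|right] => x [Cx Gx]; first by split => //; exact: CB.
    by move=> [Bx _]; exact: (CB _ Cx).
  + by right => x nGx [].
- move=> D D' [_ [[C PC ->]|->]] [_ [[C' PC' ->]|->]] DD'.
  + have [CC'|/(sepB _ _ PC PC')[n sep]] := pselect (C = C').
      by rewrite CC' in DD'.
    by exists n.+1; case: sep => [] [CB C'B]; [left|right]; split => x [xC Gx];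
      first [by split => //; exact: CB|by split => //; exact: C'B
            |by move=> [Bx _]; exact: (CB _ xC)|by move=> [Bx _]; exact: (C'B _ xC)].
  + by exists 0%N; left; split => // x [].
  + by exists 0%N; right; split => // x [].
  + by [].
Qed.

Lemma atom_pullback_partition x : G x ->
  atom pullback_partition x = pullback_atom (atom P (phi x)).
Proof.
move=> Gx; apply: (atom_eq measurable_pullback_partition).
  exact: pullback_partition_atom.
by split => //; exact: (atom_mem mP (phi x)).2.
Qed.

Lemma measure_pullback_atom C : measurable C -> mu (pullback_atom C) = nu C.
Proof.
move=> mC; have mphiC : measurable (phi @^-1` C) by exact: measurable_preim.
rewrite -(phi_mu mC); apply: (full_measure_eq mG) => //.
  exact: measurableI.
by rewrite /pullback_atom -setIA setIid.
Qed.

(** Pulling back preserves the mass of each atom, and the extra atom has mass 0, so the entropy sum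
    does not grow. *)
Lemma pullback_partition_entropy :
  partition_entropy nu P < +oo -> partition_entropy mu pullback_partition < +oo.
Proof.
move=> /partition_entropy_fin[U1 HP]; apply/partition_entropy_fin.
have nG0 : mu (~` G) = 0 by exact/full_setC.
have mC C : P C -> measurable C by exact: measurable_partition_atom.
split.
  have -> : \bigcup_(D in positive_atoms pullback_partition mu) D =
      pullback_atom (\bigcup_(C in positive_atoms P nu) C).
    apply/seteqP; split=> x.
      move=> [D [[D0 [[C PC DE]|DE]] muD] Dx].
        rewrite DE in muD Dx; case: Dx => Cx Gx; split => //.
        by exists C => //; split => //; rewrite -measure_pullback_atom //; exact: mC.
      by move: muD; rewrite DE nG0 ltxx.
    move=> [[C [PC nuC] Cx] Gx]; exists (pullback_atom C) => //; split.
      by split; [exists x|left; exists C].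
    by rewrite measure_pullback_atom //; exact: mC.
  rewrite measure_pullback_atom //.
  by have [e [me _ ->]] := enum_positive_atoms mP nu; exact: bigcupT_measurable.
apply: le_lt_trans HP.
have m_01 D : measurable D -> 0 <= mu D <= 1.
  by move=> mD; rewrite measure_ge0 probability_le1.
have mD D : pullback_partition D -> measurable D.
  by apply: measurable_partition_atom; exact: measurable_pullback_partition.
rewrite (esumID [set ~` G]); last first.
  by move=> D /mD /m_01; exact: entropy_term_ge0.
rewrite [X in X + _]esum1 ?add0e; last first.
  by move=> D [_ ->]; rewrite nG0 mul0e oppe0.
(* On classes with nonempty pullback [pullback_atom] is injective; all the others are sent to
   [set0]. *)
pose P1 := [set C | P C /\ pullback_atom C !=set0].
apply: (@le_trans _ _ (\esum_(C in P1) - (nu C * lne (nu C)))); last first.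
  by apply: ge0_subset_esum => C [].
rewrite (eq_esum (b := fun C => - (mu (pullback_atom C) * lne (mu (pullback_atom C)))));
  last by move=> C [PC _]; rewrite measure_pullback_atom //; exact: mC.
rewrite -(esum_image P1 pullback_atom (fun D => - (mu D * lne (mu D)))).
  by apply: ge0_subset_esum => D [[D0 [[C PC DE]|//]]] _;
    exists C => //; split => //; rewrite -DE.
move=> C C' /set_mem[PC [x [Cx Gx]]] /set_mem[PC' _] CC'.
have [C'x _] : pullback_atom C' x by rewrite -CC'.
by rewrite -(atom_eq mP PC Cx) -(atom_eq mP PC' C'x).
Qed.

End pullback_partition.

(** * Factor maps and isomorphisms *)

Lemma mu_ext_le1 (R : realType) (d : measure_display) (X : measurableType d)
    (mu : probability X R) (A : set X) : (mu^*)%mu A <= 1.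
Proof.
apply: le_trans (le_mu_ext mu (@subsetT _ A)) _.
by rewrite measurable_mu_extE //= probability_setT.
Qed.

Section inverse_rate.
Variables (R : realType) (d d' : measure_display).
Variables (X : measurableType d) (Y : measurableType d').
Variables (mu : probability X R) (nu : probability Y R) (f : X -> X) (g : Y -> Y).

Lemma inverse_rate_ge0 P x n : 0 <= inverse_rate f mu P x n.
Proof.
by rewrite /inverse_rate mule_ge0 // oppe_ge0 lne_le0 mu_ext_le1.
Qed.

Lemma le_inverse_rate P x Q y n :
  (mu^*)%mu (inverse_cell f Q n x) <= (nu^*)%mu (inverse_cell g P n y) ->
  inverse_rate g nu P y n <= inverse_rate f mu Q x n.
Proof.
move=> le_cell; rewrite /inverse_rate lee_wpmul2r //.
by rewrite leeN2 lee_lne // in_itv /= mu_ext_ge0 //= leey.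
Qed.

End inverse_rate.

Section cell_envelope.
Variables (R : realType) (d : measure_display) (X : measurableType d).
Variables (f : X -> X) (mu : probability X R) (muhat : probability (past_space X) R).

(** The sets are arbitrary instead of the atoms met by a past, so that cells can be indexed by
    finite words. *)
Definition invlim_cell (A : nat -> set X) (n : nat) : set X :=
  [set y | exists yhat : past_space X,
    [/\ invlim f yhat, invlim_proj yhat = y & cylinder A n yhat]].

(* A point without any past may violate the conclusion. For a fixed word the
   violating points form a measurable set, disjoint from the projection of the
   inverse limit, hence null; there are countably many words. No measurability
   of the (analytic) cells is needed. *)
Lemma invlim_cell_envelope (e : nat -> set X) :
  measurable_fun setT f -> measurable (invlim f) ->
  invlim_measure f mu muhat -> (forall k, measurable (e k)) ->
  exists N, [/\ measurable N, mu N = 1 &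
    forall (s : nat -> nat) n, exists B,
      [/\ measurable B, mu B <= (mu^*)%mu (invlim_cell (e \o s) n) &
          forall z, N z -> (forall i, (i <= n)%N -> e (s i) (iter (n - i) f z)) ->
            B (iter n f z)]].
Proof.
move=> mf mI muhatP me.
(* A word of [n.+1] letters describes the depths 0 to [n], hence the predecessor in [len]; down to
   depth [len w], the default letter is read only for the empty word. *)
pose A (w : seq nat) i := e (nth 0%N w i).
pose len (w : seq nat) := (size w).-1.
have [B HB] := choice (fun w => measurable_envelope mu (invlim_cell (A w) (len w))).
pose W w := [set z | forall i, (i <= len w)%N -> A w i (iter (len w - i) f z)].
(* [Z w] holds the points whose orbit follows [w] and yet ends outside the envelope of its cell. *)
pose Z w := W w `&` iter (len w) f @^-1` (~` B w).
have mZ w : measurable (Z w).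
  apply: measurableI; first by apply: measurable_itinerary => // i; exact: me.
  apply: measurable_preim; first exact: measurable_iter.
  by apply: measurableC; have [] := HB w.
have Z0 w : mu (Z w) = 0.
  (* Read [Z w] as an event on coordinate [len w]: a past with such a point there has its coordinate
     0 in the cell, hence in the envelope, a contradiction. *)
  rewrite -(invlim_measure_coord (len w) mf muhatP (mZ w)).
  apply: (@subset_measure0 _ _ _ muhat _ (~` invlim f)).
  - exact: measurable_past_preim.
  - exact: measurableC.
  - move=> x [Wx nBx] fx; apply: nBx; have [_ + _] := HB w; apply.
    exists x; split => //; last exact/(invlim_cylinder _ _ fx).
    by have := iter_invlim fx (leq0n (len w)); rewrite subn0.
  - by have [/(full_setC _ mI)] := muhatP.
(* Pickling enumerates all words; codes that decode to nothing yield the empty word. *)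
pose word k := odflt [::] (choice.unpickle k : option (seq nat)).
exists [set z | forall k, (~` Z (word k)) z]; split.
- by apply: measurable_forall_nat => k; exact: measurableC.
- apply: full_measure_bigcap => k; first exact: measurableC.
  by apply/full_setC; [exact: measurableC|rewrite setCK].
move=> s n; pose w := mkseq s n.+1.
have len_w : len w = n by rewrite /len size_mkseq.
have A_w i : (i <= n)%N -> A w i = e (s i) by move=> le_in; rewrite /A nth_mkseq.
have [mB _ leB] := HB w; exists (B w); split => //.
  apply: (le_trans leB); apply: le_mu_ext => y [yhat [fy yE Ay]].
  exists yhat; split => // i le_in.
  by have := Ay i; rewrite len_w A_w //; exact.
move=> z /(_ (choice.pickle w)) NZ Ez; apply: contrapT => nB; apply: NZ.
rewrite /word choice.pickleK /=; split; last by rewrite /= len_w.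
by move=> i; rewrite len_w => le_in; rewrite A_w //; exact: Ez.
Qed.

End cell_envelope.

(** * Comparison of the entropies along a factor map *)

Section factor.
Variables (R : realType) (dX dY : measure_display).
Variables (X : measurableType dX) (Y : measurableType dY).
Variables (mu : probability X R) (nu : probability Y R).
Hypotheses (sbX : standard_borel R X) (sbY : standard_borel R Y).
Variables (f : X -> X) (g : Y -> Y).
Hypotheses (mf : measurable_fun setT f) (mg : measurable_fun setT g).
Variables (muhat : probability (past_space X) R) (nuhat : probability (past_space Y) R).
Hypotheses (muhatP : invlim_measure f mu muhat) (nuhatP : invlim_measure g nu nuhat).
Variable phi : X -> Y.
Hypotheses (mphi : measurable_fun setT phi).
Hypothesis semiconj : {ae mu, forall x, phi (f x) = g (phi x)}.
Hypothesis phi_mu : preserves_measure mu nu phi.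

Definition past_map (x : past_space X) : past_space Y :=
  fun i => phi (past_coord i x).

Lemma measurable_past_map : measurable_fun setT past_map.
Proof.
apply: measurable_into_past => i.
by apply: (measurableT_comp mphi); exact: measurable_past_coord.
Qed.

Definition pasts_in (G : set X) : set (past_space X) :=
  [set x | invlim f x /\ forall i, G (past_coord i x)].

(** Every coordinate has law [mu], so the pasts that leave [G] at some depth form a countable union
    of null sets. *)
Lemma pasts_in_full G : measurable G -> mu G = 1 ->
  measurable (pasts_in G) /\ muhat (pasts_in G) = 1.
Proof.
move=> mG G1; have mI := measurable_invlim sbX mf.
have mGi i : measurable (past_coord i @^-1` G) by exact: measurable_past_preim.
have mGT : measurable [set x | forall i, (past_coord i @^-1` G) x].
  exact: measurable_forall_nat.
have [I1 _ _] := muhatP.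
split; first exact: measurableI.
apply: full_measureI => //; apply: full_measure_bigcap => // i.
by rewrite -G1; exact: (invlim_measure_coord i mf muhatP).
Qed.

(** Almost every past stays where the semiconjugacy holds, so the image of [muhat] is carried by
    [invlim g]; its coordinates have law [nu]. These properties characterise [nuhat]. *)
Lemma preserves_past_map : preserves_measure muhat nuhat past_map.
Proof.
move=> C mC; have [G [mG G1 semiG]] := ae_full_measure semiconj.
have [mE E1] := pasts_in_full mG G1.
have mI := measurable_invlim sbY mg.
pose h : {mfun past_space X >-> past_space Y} :=
  HB.pack past_map (isMeasurableFun.Build _ _ _ _ _ measurable_past_map).
suff : distribution muhat h C = nuhat C by [].
apply: (invlim_measure_unique (f := g) (mu := nu)) => //.
- apply: (full_measure_ge mE _ E1) => [|x [fx Gx] i].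
    by apply: measurable_preim => //; exact: measurable_past_map.
  by rewrite /past_map -(semiG _ (Gx _)) /past_coord fx.
- by case: nuhatP.
- move=> i A mA; rewrite -(phi_mu mA).
  apply: (invlim_measure_coord i mf muhatP); exact: measurable_preim.
- by move=> i; exact: (invlim_measure_coord i mg nuhatP).
Qed.

(** Membership in [G] is asked only down to depth [n], because an inverse cell controls a past no
    further. *)
Lemma iter_semiconj (G : set X) (x : past_space X) n i :
  (forall y, G y -> phi (f y) = g (phi y)) -> invlim f x ->
  (forall j, (j <= n)%N -> G (past_coord j x)) -> (i <= n)%N ->
  iter (n - i) g (phi (past_coord n x)) = phi (past_coord i x).
Proof.
move=> semiG fx; elim: n => [|n IH] Gx le_in.
  by move: le_in; rewrite leqn0 => /eqP->.
move: le_in; rewrite leq_eqVlt => /predU1P[->|]; first by rewrite subnn.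
rewrite ltnS => le_in; rewrite subSn // iterSr -(semiG _ (Gx _ (leqnn _))).
rewrite {2}/past_coord fx; apply: IH => // j /leqW; exact: Gx.
Qed.

Lemma factor_partition P : finite_entropy_partitions nu P ->
  exists2 Q, finite_entropy_partitions mu Q & exists E,
    [/\ measurable E, muhat E = 1, E `<=` invlim f &
        forall x n, E x ->
          inverse_rate g nu P (past_map x) n <= inverse_rate f mu Q x n].
Proof.
move=> [mP HP]; have [G0 [mG0 G01 semiG]] := ae_full_measure semiconj.
have [e [me eP eU]] := enum_positive_atoms mP nu.
have [N [mN N1 HN]] := invlim_cell_envelope mg (measurable_invlim sbY mg) nuhatP me.
have [U1 _] := (partition_entropy_fin _ _).1 HP.
have mU : measurable (\bigcup_(C in positive_atoms P nu) C).
  by rewrite eU; exact: bigcupT_measurable.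
have mN' : measurable (phi @^-1` N) by exact: measurable_preim.
have mU' := measurable_preim mphi mU.
pose G := G0 `&` phi @^-1` N.
have mG : measurable G by exact: measurableI.
have G1 : mu G = 1 by apply: full_measureI => //; rewrite phi_mu.
(* The partition is built from [G] alone. [V] further restricts the base pasts to those whose images
   meet only atoms of positive measure, so that [e] spells their words. *)
pose V := G `&` phi @^-1` (\bigcup_(C in positive_atoms P nu) C).
have mV : measurable V by exact: measurableI.
have V1 : mu V = 1 by apply: full_measureI => //; rewrite phi_mu.
exists (pullback_partition phi P G).
  split; first exact: measurable_pullback_partition.
  exact: (pullback_partition_entropy (nu := nu)).
have [mE E1] := pasts_in_full mV V1; exists (pasts_in V); split => //.
  by move=> x [].
move=> x n [fx Vx]; apply: le_inverse_rate.
have xP i : exists k, e k = atom P (phi (past_coord i x)).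
  have [_ [C PC Cx]] := Vx i; have [k ek] := eP C PC.
  by exists k; rewrite ek (atom_eq mP PC.1 Cx).
have [s sP] := choice xP; have [B [mB leB BP]] := HN s n.
apply: (@le_trans _ _ (nu B)); last first.
  apply: (le_trans leB); apply: le_mu_ext => y [yhat [gy yE sy]].
  by exists yhat; split => // i le_in; have := sy i le_in; rewrite /= sP.
(* It remains to place the cell of [x] inside the preimage of [B]. *)
rewrite -(phi_mu mB) -measurable_mu_extE; last exact: measurable_preim.
apply: le_mu_ext => y [yhat [fy <- Qy]].
(* Sharing pulled back atoms with [x] forces [yhat] to stay in [G] down to depth [n]. *)
have Qyi i : (i <= n)%N -> e (s i) (phi (past_coord i yhat)) /\ G (past_coord i yhat).
  move=> le_in; have := Qy i le_in; have [Gx _] := Vx i.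
  by rewrite (atom_pullback_partition mphi mP mG Gx) sP.
have itery i : (i <= n)%N ->
    iter (n - i) g (phi (past_coord n yhat)) = phi (past_coord i yhat).
  by apply: (iter_semiconj (G := G)) => // [z [/semiG]|j /Qyi []].
(* The envelope property is applied to [phi (past_coord n yhat)], whose [g]-orbit spells [s] and
   after [n] steps reaches the image of the present. *)
have := itery 0%N (leq0n n); rewrite subn0 => iterny.
rewrite /= -[invlim_proj yhat]/(past_coord 0 yhat) -iterny; apply: BP.
  by have [_ [_ ]] := Qyi n (leqnn n).
by move=> i le_in; rewrite itery //; have [] := Qyi i le_in.
Qed.

Lemma factor_h_inf : h_inf g nu nuhat <= h_inf f mu muhat.
Proof.
apply: ge_ereal_sup => _ [P /factor_partition[Q HQ [E [mE E1 EI PQ]]] <-].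
apply: (@le_trans _ _ (h_inf_partition f mu muhat Q)); last first.
  by apply: ereal_sup_ubound; exists Q.
apply: (ge0_le_integral_transfer _ measurable_past_map preserves_past_map mE E1) => //.
- by move=> x; apply: limn_einf_ge0 => n; exact: inverse_rate_ge0.
- by move=> x; apply: limn_einf_ge0 => n; exact: inverse_rate_ge0.
- by move=> x Ex; apply: le_limn_einf => n; exact: PQ.
Qed.

Lemma factor_h_sup : h_sup g nu nuhat <= h_sup f mu muhat.
Proof.
apply: ge_ereal_sup => _ [P /factor_partition[Q HQ [E [mE E1 EI PQ]]] <-].
apply: (@le_trans _ _ (h_sup_partition f mu muhat Q)); last first.
  by apply: ereal_sup_ubound; exists Q.
apply: (ge0_le_integral_transfer _ measurable_past_map preserves_past_map mE E1) => //.
- by move=> x; apply: limn_esup_ge0 => n; exact: inverse_rate_ge0.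
- by move=> x; apply: limn_esup_ge0 => n; exact: inverse_rate_ge0.
- by move=> x Ex; apply: le_limn_esup => n; exact: PQ.
Qed.

End factor.

(** The inverse of the bijection between [X0] and [Y0] is extended by a constant off [Y0]. This
    gives a factor map in the other direction. *)
Lemma probability_isomorphism_inverse (R : realType) (dX dY : measure_display)
    (X : measurableType dX) (Y : measurableType dY)
    (mu : probability X R) (nu : probability Y R)
    (f : X -> X) (g : Y -> Y) (phi : X -> Y) :
  measurable_fun setT f -> preserves_measure mu mu f ->
  probability_isomorphism mu nu phi ->
  {ae mu, forall x, phi (f x) = g (phi x)} ->
  exists psi : Y -> X, [/\ measurable_fun setT psi,
    {ae nu, forall y, psi (g y) = f (psi y)} & preserves_measure nu mu psi].
Proof.
move=> mf inv_f [mphi phi_mu [X0 [Y0 [[mX0 X01] [mY0 Y01] bij_phi im_phi]]]].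
move=> /ae_full_measure[G [mG G1 semiG]].
have [phiXY phiI phiS] := bij_phi.
have phi_nu A : measurable A -> A `<=` X0 -> nu (phi @` A) = mu A.
  move=> mA AX0; rewrite -(phi_mu _ (im_phi _ mA AX0)).
  apply: (full_measure_eq mX0) => //.
    by apply: measurable_preim => //; exact: im_phi.
  apply/seteqP; split=> x [Ax X0x]; split => //; last by exists x.
  have [x' Ax' xx'] := Ax.
  by rewrite -(phiI x' x (mem_set (AX0 _ Ax')) (mem_set X0x) xx').
have HY y : exists x, Y0 y -> X0 x /\ phi x = y.
  have [Y0y|nY0y] := pselect (Y0 y); last by exists point.
  by have [x X0x xy] := phiS y Y0y; exists x.
have [psi0 psi0P] := choice HY.
pose psi y := if pselect (Y0 y) then psi0 y else point.
have psiE x : X0 x -> psi (phi x) = x.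
  move=> X0x; rewrite /psi; case: pselect => [Y0y|]; last by case; exact: phiXY.
  have [X0x' xx'] := psi0P _ Y0y.
  exact: (phiI _ _ (mem_set X0x') (mem_set X0x) xx').
(* Within [Y0], preimages under [psi] are images under [phi], which are measurable by assumption and
   whose measure is given by [phi_nu]. *)
have preim_psi A : psi @^-1` A `&` Y0 = phi @` (A `&` X0).
  apply/seteqP; split=> [y [/= Ay Y0y]|_ [x [Ax X0x] <-]].
    have [x X0x xy] := phiS y Y0y; exists x => //; split => //.
    by rewrite -(psiE x X0x) xy.
  by split; [rewrite /= psiE|exact: phiXY].
have im_meas A : measurable A -> measurable (phi @` (A `&` X0)).
  by move=> mA; apply: im_phi => [|x []] //; exact: measurableI.
have mpsi : measurable_fun setT psi.
  move=> _ A mA; rewrite setTI.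
  have -> : psi @^-1` A = phi @` (A `&` X0) `|` (~` Y0 `&` [set y | A point]).
    rewrite -preim_psi; apply/seteqP; split=> y /=; rewrite /psi.
      by case: pselect => /= Y0y Ay; [left|right].
    by move=> [[]|[]]; case: pselect.
  apply: measurableU; first exact: im_meas.
  have [Ap|nAp] := pselect (A point).
    rewrite (_ : [set y | A point] = setT); last by apply/seteqP; split=> y.
    by rewrite setIT; exact: measurableC.
  by rewrite (_ : [set y | A point] = set0) ?setI0 //; apply/seteqP; split=> y.
exists psi; split => //.
(* Both [x] and [f x] must lie in [X0] for [psi] to undo [phi] there; invariance of [mu] gives the
   preimage of [X0] under [f] full measure. *)
- pose E := G `&` f @^-1` X0.
  have mfX0 : measurable (f @^-1` X0) by exact: measurable_preim.
  have mE : measurable E by exact: measurableI.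
  have E1 : mu (E `&` X0) = 1.
    by apply: full_measureI => //; apply: full_measureI => //; rewrite inv_f.
  exists (~` (phi @` (E `&` X0))); split.
  + exact/measurableC/im_meas.
  + apply/full_setC; first exact: im_meas.
    by rewrite phi_nu //; exact: measurableI.
  + apply: subsetC => _ [x [[Gx X0fx] X0x] <-] /=.
    by rewrite -semiG // !psiE.
- move=> A mA; rewrite (@full_measure_eq _ _ _ _ Y0 _ (phi @` (A `&` X0))) //.
  + rewrite phi_nu //; last exact: measurableI.
    apply: (full_measure_eq mX0) => //; first exact: measurableI.
    by rewrite -setIA setIid.
  + exact: measurable_preim.
  + exact: im_meas.
  + by rewrite -preim_psi -setIA setIid.
Qed.

Theorem proposition2p14 (R : realType) (dX dY : measure_display)
    (X : measurableType dX) (Y : measurableType dY)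
    (mu : probability X R) (nu : probability Y R)
    (sbX : standard_borel R X) (sbY : standard_borel R Y)
    (f : X -> X) (g : Y -> Y)
    (mf : measurable_fun setT f) (mg : measurable_fun setT g)
    (inv_f : preserves_measure mu mu f) (inv_g : preserves_measure nu nu g)
    (muhat : probability (past_space X) R) (nuhat : probability (past_space Y) R)
    (muhatP : invlim_measure f mu muhat) (nuhatP : invlim_measure g nu nuhat) :
  [/\ (forall phi : X -> Y,
        measurable_fun setT phi ->
        {ae mu, forall x, phi (f x) = g (phi x)} ->
        preserves_measure mu nu phi ->
        h_inf g nu nuhat <= h_inf f mu muhat /\
        h_sup g nu nuhat <= h_sup f mu muhat),
      (forall phi : X -> Y,
        probability_isomorphism mu nu phi ->
        {ae mu, forall x, phi (f x) = g (phi x)} ->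
        preserves_measure mu nu phi ->
        h_inf f mu muhat = h_inf g nu nuhat /\
        h_sup f mu muhat = h_sup g nu nuhat) &
      (forall phi : X -> Y,
        probability_isomorphism mu nu phi ->
        {ae mu, forall x, phi (f x) = g (phi x)} ->
        preserves_measure mu nu phi ->
        has_inverse_partition_entropy f mu muhat ->
        has_inverse_partition_entropy g nu nuhat /\
        inverse_partition_entropy f mu muhat =
        inverse_partition_entropy g nu nuhat)].
Proof.
have factor (phi : X -> Y) : measurable_fun setT phi ->
    {ae mu, forall x, phi (f x) = g (phi x)} -> preserves_measure mu nu phi ->
    h_inf g nu nuhat <= h_inf f mu muhat /\ h_sup g nu nuhat <= h_sup f mu muhat.
  move=> mphi semi phi_mu; split.
    exact: (factor_h_inf sbX sbY mf mg muhatP nuhatP mphi semi phi_mu).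
  exact: (factor_h_sup sbX sbY mf mg muhatP nuhatP mphi semi phi_mu).
have iso (phi : X -> Y) : probability_isomorphism mu nu phi ->
    {ae mu, forall x, phi (f x) = g (phi x)} -> preserves_measure mu nu phi ->
    h_inf f mu muhat = h_inf g nu nuhat /\ h_sup f mu muhat = h_sup g nu nuhat.
  move=> iso_phi semi phi_mu; have [mphi _ _] := iso_phi.
  have [le_inf le_sup] := factor phi mphi semi phi_mu.
  have [psi [mpsi semi' psi_nu]] :=
    probability_isomorphism_inverse mf inv_f iso_phi semi.
  split; apply/eqP; rewrite eq_le ?le_inf ?le_sup andbT.
    exact: (factor_h_inf sbY sbX mg mf nuhatP muhatP mpsi semi' psi_nu).
  exact: (factor_h_sup sbY sbX mg mf nuhatP muhatP mpsi semi' psi_nu).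
split => // phi iso_phi semi phi_mu h_eq.
have [e_inf e_sup] := iso phi iso_phi semi phi_mu.
by split => //; rewrite /has_inverse_partition_entropy -e_inf -e_sup.
Qed.
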